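(* For each integer $n\ge 1$ let $\pi$ be a uniformly random permutation of the set $\{0,1,\dots,2^n-1\}$, and let $\gamma_\pi(s)$ be the eigenvalue gap between the two lowest energy levels of $H_\pi(s)$. Then $$\Pr\left[\gamma_\pi(s)>0.8\ \text{ for all } 0.9\le s\le 1\right]\longrightarrow 1\quad\text{as } n\to\infty.$$
   Context: Fix $n\ge1$. Identify the integers $z\in\{0,1,\dots,2^n-1\}$ with $n$-bit strings via binary expansion, and let $W(z)$ be the Hamming weight of $z$ (the number of ones in the string). Let $\{|z\rangle\}$ be the standard orthonormal basis of $(\mathbb{C}^2)^{\otimes n}\cong\mathbb{C}^{2^n}$ indexed by $n$-bit strings. Let $\sigma_x^i$ be the Pauli $x$ operator acting on the $i$-th qubit, i.e. $\sigma_x^i|z\rangle=|z\oplus e_i\rangle$, where $z\oplus e_i$ is $z$ with its $i$-th bit flipped. For a permutation $\pi$ of $\{0,1,\dots,2^n-1\}$ (a permutation of the $2^n$ strings, not of the $n$ bits) and real $s$, define the Hermitian operator $$H_\pi(s)=(1-s)\sum_{i=1}^n\left(\frac{1-\sigma_x^i}{2}\right)+s\sum_{z=0}^{2^n-1}W(\pi^{-1}(z))\,|z\rangle\langle z|.$$ The gap $\gamma_\pi(s)$ is the second smallest minus the smallest eigenvalue of $H_\pi(s)$, eigenvalues being counted with multiplicity. Probabilities are over $\pi$ chosen uniformly from all $(2^n)!$ permutations. *)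

(* Defs.v *)
From HB Require Import structures.
From mathcomp Require Import all_boot all_order all_algebra all_fingroup.
From mathcomp Require Import complex.
From mathcomp Require Import all_classical all_reals all_analysis.

Set Implicit Arguments.
Unset Strict Implicit.
Unset Printing Implicit Defensive.

Import Order.TTheory GRing.Theory Num.Theory.
Import numFieldNormedType.Exports.

Local Open Scope ring_scope.
Local Open Scope complex_scope.

(* Bit [i] of [z] in its binary expansion, bit 0 being the least significant. *)
Definition bit (z i : nat) : bool := odd (z %/ 2 ^ i).

Definition weight (n : nat) (z : 'I_(2 ^ n)) : nat := (\sum_(i < n) bit z i)%N.

Definition is_flip (n : nat) (i : 'I_n) (y z : 'I_(2 ^ n)) : bool :=
  [forall j : 'I_n, bit y j == bit z j (+) (j == i)].

(* Column [z] is the vector sigma_x^i |z> = |z (+) e_i>. *)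
Definition sigma_x (R : realType) (n : nat) (i : 'I_n) : 'M[R[i]]_(2 ^ n) :=
  \matrix_(y, z) (is_flip i y z)%:R.

(* [delta_mx z z] is the projector |z><z|. *)
Definition hamiltonian (R : realType) (n : nat) (pi : 'S_(2 ^ n)) (s : R) :
    'M[R[i]]_(2 ^ n) :=
  (1 - s)%:C *: (\sum_(i < n) 2^-1 *: (1%:M - sigma_x R i))
  + s%:C *: (\sum_(z < 2 ^ n) (weight ((pi^-1)%g z))%:R *: delta_mx z z).

(* All roots of the characteristic polynomial, repeated according to
   multiplicity. *)
Definition spectrum (R : realType) (m : nat) (A : 'M[R[i]]_m) : seq R[i] :=
  sval (closed_field_poly_normal (char_poly A)).

(* Meant for Hermitian matrices only: their spectrum is real, so taking real
   parts loses nothing. *)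
Definition energies (R : realType) (m : nat) (A : 'M[R[i]]_m) : seq R :=
  sort <=%R [seq complex.Re x | x <- spectrum A].

(* Second smallest minus smallest eigenvalue; the default value of [nth] is
   only reached when the dimension is less than 2. *)
Definition gap (R : realType) (n : nat) (pi : 'S_(2 ^ n)) (s : R) : R :=
  let E := energies (hamiltonian pi s) in E`_1 - E`_0.

Definition prob_perm (R : realType) (m : nat) (P : 'S_m -> Prop) : R :=
  #|[set pi : 'S_m | `[< P pi >] ]|%:R / #|[set: 'S_m]|%:R.

(* Main.v *)
(* Write H - (1-s)n/2 = s D - (1-s)/2 Adj with D the diagonal part and Adj the
   adjacency matrix of the hypercube, and let k be the vertex with D k = 0. As
   the Rayleigh quotient of H at |k> is (1-s)n/2, it suffices that
   H >= (1-s)n/2 + 0.81 on vectors vanishing at k. By Barta's argument this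
   follows from a positive f with (H f) z >= ((1-s)n/2 + 0.81) f z for z != k.
   Take f = 3n/5 at the low vertices, those with D z <= n/10, and f = 1
   elsewhere: since s >= 9/10 this works as soon as n >= 81 and no two low
   vertices are within Hamming distance 2. There are at most (45/32)^n low
   vertices and (45/32)^2 < 2, so a union bound over pairs shows that for a
   random permutation such a close pair exists with exponentially small
   probability. *)
Require Import Defs.
From mathcomp Require Import all_boot all_order all_algebra all_fingroup.
From mathcomp Require Import all_classical all_reals all_analysis.
From mathcomp Require Import complex spectral sesquilinear zify ring lra.

Set Implicit Arguments.
Unset Strict Implicit.
Unset Printing Implicit Defensive.

Import Order.TTheory GRing.Theory Num.Theory.
Import numFieldNormedType.Exports.

Local Open Scope ring_scope.

(** * The hypercube *)

Lemma bit_inj n (y z : 'I_(2 ^ n)) : (forall i : 'I_n, bit y i = bit z i) -> y = z.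
Proof.
move=> yz; apply/val_inj => /=; case: y z yz => y yn [z zn] /= yz.
elim: n y z yn zn yz => [|n IHn] y z.
  by rewrite expn0 !ltnS !leqn0 => /eqP-> /eqP->.
rewrite expnSr -!ltn_divLR // => yn zn yz.
rewrite (divn_eq y 2) (divn_eq z 2) (IHn _ _ yn zn) => [|i].
  by rewrite !modn2; have := yz ord0; rewrite /bit expn0 !divn1 => ->.
by have := yz (lift ord0 i); rewrite /bit /= /bump /= add1n expnS !divnMA.
Qed.

Lemma is_flip_sym n (i : 'I_n) y z : is_flip i y z = is_flip i z y.
Proof.
by apply/forallP/forallP => fl j; rewrite (eqP (fl j)) -addbA addbb addbF.
Qed.

Lemma is_flip_inj n (i : 'I_n) y y' z : is_flip i z y -> is_flip i z y' -> y = y'.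
Proof.
rewrite ![is_flip i z _]is_flip_sym => /forallP fl /forallP fl'.
by apply: bit_inj => j; rewrite (eqP (fl j)) (eqP (fl' j)).
Qed.

Lemma is_flip_index n (i j : 'I_n) y z : is_flip i y z -> is_flip j y z -> i = j.
Proof.
move=> /forallP/(_ i)/eqP yi /forallP/(_ i)/eqP; rewrite yi eqxx.
by move/addbI/esym/eqP.
Qed.

Definition edge n (y z : 'I_(2 ^ n)) := [exists i : 'I_n, is_flip i y z].

(** Encoded as a walk of one or two edges, so that degrees can be counted; a walk of two edges may
    return to its start. *)
Definition dist_le2 n (y z : 'I_(2 ^ n)) :=
  edge y z || [exists w, edge y w && edge w z].

Lemma edge_sym n (y z : 'I_(2 ^ n)) : edge y z = edge z y.
Proof. by apply: eq_existsb => i; apply: is_flip_sym. Qed.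

Lemma edge_irr n (z : 'I_(2 ^ n)) : edge z z = false.
Proof.
apply/existsP => -[i /forallP/(_ i)]; rewrite eqxx addbT.
by case: (bit z i).
Qed.

(** Two strings determine the flipped bit, so at most one term is nonzero. This turns the sum of the
    [sigma_x] into the adjacency matrix of the hypercube. *)
Lemma sum_is_flip n (y z : 'I_(2 ^ n)) : (\sum_(i < n) is_flip i y z = edge y z)%N.
Proof.
rewrite /edge; case: existsP => [[i fl]|nfl].
  rewrite (bigD1 i) //= fl big1 // => j jNi.
  by case: (boolP (is_flip j y z)) => // /(is_flip_index fl) ij; rewrite ij eqxx in jNi.
by rewrite big1 // => i _; case: (boolP (is_flip i y z)) => // fl; case: nfl; exists i.
Qed.

Lemma edge_degree n (y : 'I_(2 ^ n)) : (\sum_z edge y z <= n)%N.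
Proof.
under eq_bigr do rewrite -sum_is_flip.
rewrite exchange_big /= -[leqRHS]card_ord -sum1_card; apply: leq_sum => i _.
have [z fl|nfl] := pickP (is_flip i y).
  rewrite (bigD1 z) //= fl big1 // => z' z'Nz.
  by case: (boolP (is_flip i y z')) => // /(is_flip_inj fl) zz; rewrite zz eqxx in z'Nz.
by rewrite big1 // => z _; rewrite nfl.
Qed.

Lemma dist_le2_degree n (y : 'I_(2 ^ n)) : (#|dist_le2 y| <= n + n * n)%N.
Proof.
rewrite -sum1_card big_mkcond /=.
apply: (@leq_trans (\sum_z (edge y z + \sum_w edge y w * edge w z))%N).
  apply: leq_sum => z _; rewrite unfold_in /= /dist_le2.
  case: (edge y z) => //=; case: existsP => // -[w ywz].
  by rewrite (bigD1 w) //= mulnb ywz.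
rewrite big_split leq_add ?edge_degree // exchange_big /=.
under eq_bigr do rewrite -big_distrr.
apply: (@leq_trans (\sum_w edge y w * n)%N).
  by apply: leq_sum => w _; rewrite leq_mul2l edge_degree orbT.
by rewrite -big_distrl leq_mul2r edge_degree orbT.
Qed.

(** * Hamming weights and the number of light strings *)

Definition bits n (z : 'I_(2 ^ n)) : {set 'I_n} := [set i : 'I_n | bit z i].

Lemma bits_inj n : injective (@bits n).
Proof. by move=> y z /setP yz; apply: bit_inj => i; have := yz i; rewrite !inE. Qed.

Lemma weightE n (z : 'I_(2 ^ n)) : weight z = #|bits z|.
Proof.
by rewrite /weight -sum1_card [RHS]big_mkcond; apply: eq_bigr => i _; rewrite inE.
Qed.

Lemma weight_eq0 n (y z : 'I_(2 ^ n)) : weight y = 0%N -> weight z = 0%N -> y = z.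
Proof.
rewrite !weightE => /eqP + /eqP; rewrite !cards_eq0 => /eqP y0 /eqP z0.
by apply: bits_inj; rewrite y0 z0.
Qed.

Lemma weight0 n (z : 'I_(2 ^ n)) : z = 0%N :> nat -> weight z = 0%N.
Proof. by move=> z0; rewrite /weight big1 // => i _; rewrite z0 /bit div0n. Qed.

(** Expanding the product over the bits gives the sum of [x ^+ #|A|] over all sets of bits, and
    [bits] embeds the strings among these sets. *)
Lemma weight_gf (R : realFieldType) n (x : R) : 0 <= x ->
  \sum_(z < 2 ^ n) x ^+ weight z <= (1 + x) ^+ n.
Proof.
move=> x_ge0; rewrite -[in leRHS](card_ord n) -prodr_const addrC bigA_distr /=.
under eq_bigr do rewrite weightE.
rewrite -(big_imset (fun A : {set 'I_n} => x ^+ #|A|) (A := predT)) /=; last first.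
  by move=> y z _ _; apply: bits_inj.
rewrite big_mkcond; apply: ler_sum => A _.
have -> : \prod_i (if i \in A then x else 1) = x ^+ #|A|.
  by rewrite -big_mkcond /= prodr_const.
by case: ifP => // _; rewrite exprn_ge0.
Qed.

(** The preimages under [pi] of the low vertices. *)
Definition light n : {set 'I_(2 ^ n)} := [set a | (10 * weight a <= n)%N].

(* Chernoff: [8 ^ weight <= (5/4) ^ n] on light strings since [8 <= (5/4) ^ 10]. *)
Lemma card_light (R : realFieldType) n : #|light n|%:R <= (45 / 32) ^+ n :> R.
Proof.
have -> : 45 / 32 = 5 / 4 * (1 + 8^-1) :> R by field.
rewrite exprMn; apply: le_trans (ler_wpM2l _ (weight_gf n _)); last 2 first.
- by rewrite exprn_ge0.
- by [].
rewrite mulr_sumr -sum1_card natr_sum big_mkcond /=; apply: ler_sum => a _.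
rewrite inE; case: ifP => [an|_]; last by rewrite mulr_ge0 // exprn_ge0.
rewrite exprVn ler_pdivlMr ?exprn_gt0 // mul1r.
apply: (@le_trans _ _ ((5 / 4) ^+ (10 * weight a))).
  by rewrite exprM lerXn2r ?nnegrE ?exprn_ge0 //; lra.
by rewrite ler_weXn2l //; lra.
Qed.

(** * Random permutations *)

Section RandomPermutation.

Variables (m D : nat) (r : rel 'I_m).
Hypothesis degree_r : forall u, (#|r u| <= D)%N.

(* Right multiplication by [tperm b c] permutes the sample space, so the count
   is the same for each of the [m.-1] choices of [c != a] in place of [b]. *)
Lemma card_perm_related (a b : 'I_m) : a != b ->
  (m.-1 * #|[set s : 'S_m | r (s a) (s b)]| <= D * m`!)%N.
Proof.
move=> aNb.
have swap c : c != a ->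
    #|[set s : 'S_m | r (s a) (s c)]| = #|[set s : 'S_m | r (s a) (s b)]|.
  move=> cNa; rewrite -(card_imset _ (mulgI (tperm b c))).
  apply: eq_card => s; rewrite !inE; apply/imsetP/idP => [[s' + ->]|rs].
    by rewrite !inE !permM tpermL tpermD // eq_sym.
  exists (tperm b c * s)%g; last by rewrite mulgA tperm2 mul1g.
  by rewrite inE !permM tpermR tpermD // eq_sym.
have <- : (\sum_(c | c != a) #|[set s : 'S_m | r (s a) (s c)]| =
           m.-1 * #|[set s : 'S_m | r (s a) (s b)]|)%N.
  rewrite (eq_bigr _ swap) sum_nat_const; congr (_ * _)%N.
  by rewrite (@eq_card _ _ (predC1 a)) // cardC1 card_ord.
under eq_bigr do rewrite -sum1_card big_mkcond /=.
(* Counted the other way, each [s] contributes the number of [c != a] with [s c] related to [s a];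
   as [s] is injective, this is at most the degree of [s a]. *)
rewrite exchange_big /= -[m`!](card_Sn m) -[#|'S_m|]sum1_card big_distrr /=.
apply: leq_sum => s _; rewrite muln1; apply: leq_trans (degree_r (s a)).
rewrite -sum1_card [leqRHS]big_mkcond [leqLHS]big_mkcond /=.
rewrite [leqRHS](reindex_inj (@perm_inj _ s)); apply: leq_sum => c _.
by rewrite inE unfold_in; case: (c != a).
Qed.

(** Union bound over the ordered pairs in [A]; the diagonal pairs contribute nothing. *)
Lemma card_perm_related_in (A : {set 'I_m}) :
  (m.-1 * #|[set s : 'S_m | [exists a in A, exists b in A, (a != b) && r (s a) (s b)]]|
    <= #|A| * #|A| * (D * m`!))%N.
Proof.
pose B (a b : 'I_m) := [set s : 'S_m | (a != b) && r (s a) (s b)].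
apply: (@leq_trans (\sum_(a in A) \sum_(b in A) m.-1 * #|B a b|)%N).
  under eq_bigr do rewrite -big_distrr.
  rewrite -big_distrr leq_mul2l; apply/orP; right.
  rewrite -sum1_card.
  under [leqRHS]eq_bigr do under eq_bigr do rewrite -sum1_card big_mkcond.
  under [leqRHS]eq_bigr do rewrite exchange_big.
  rewrite exchange_big big_mkcond; apply: leq_sum => s _; rewrite inE.
  case: exists_inP => // -[a aA /exists_inP[b bA abs]].
  by rewrite (bigD1 a) //= (bigD1 b) //= inE abs.
rewrite -mulnA -sum_nat_const; apply: leq_sum => a _.
rewrite -sum_nat_const; apply: leq_sum => b _.
have [ab|aNb] := eqVneq a b.
  rewrite (_ : B a b = finset.set0) ?cards0 ?muln0 //.
  by apply/setP => s; rewrite !inE ab eqxx.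
have -> : B a b = [set s : 'S_m | r (s a) (s b)] by apply/setP => s; rewrite !inE aNb.
exact: card_perm_related.
Qed.

End RandomPermutation.

(** * Eigenvalues of real symmetric matrices *)

(** The numerator of the Rayleigh quotient; with [1%:M] in place of [A] it is the denominator. *)
Definition quad (R : pzRingType) m (A : 'M[R]_m) (x : 'rV[R]_m) : R :=
  \sum_y \sum_z x 0 y * A y z * x 0 z.

Lemma quad1 (R : pzRingType) m (x : 'rV[R]_m) : quad 1%:M x = \sum_i x 0 i ^+ 2.
Proof.
apply: eq_bigr => y _; rewrite (bigD1 y) //= big1 ?addr0 => [|z zNy].
  by rewrite mxE eqxx mulr1 expr2.
by rewrite mxE eq_sym (negPf zNy) mulr0 mul0r.
Qed.

Section SymmetricSpectrum.

Local Open Scope complex_scope.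
Local Open Scope sesquilinear_scope.

Variables (R : realType) (m : nat) (A : 'M[R]_m).
Hypothesis symA : A^T = A.

Local Notation AC := (map_mx (real_complex R) A).

(** The spectral theorem for the Hermitian matrix [AC]. The diagonal entries are the spectrum with
    multiplicity because similar matrices have the same characteristic polynomial and its linear
    factors are unique. *)
Lemma symmetric_diagonalization : exists (P : 'M[R[i]]_m) (d : 'I_m -> R),
  [/\ P \is unitarymx,
      AC = P^t* *m diag_mx (\row_i (d i)%:C) *m P &
      perm_eq [seq complex.Re x | x <- spectrum AC] [seq d i | i <- enum 'I_m]].
Proof.
have hermAC : AC \is hermsymmx.
  apply: realsym_hermsym.
    apply/eqP; rewrite expr0 scale1r map_mx_id //.
    by rewrite map_trmx symA.
  by apply/mxOverP => i j; rewrite mxE; apply/complex_realP; exists (A i j).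
have /orthomx_spectralP := hermitian_normalmx hermAC.
have := spectral_unitarymx AC; have := hermitian_spectral_diag_real hermAC.
set P := spectralmx AC; set D := spectral_diag AC => Dreal Punit defA.
have defD : D = \row_i (complex.Re (D 0 i))%:C.
  by apply/rowP => i; rewrite mxE RRe_real // (mxOverP Dreal).
exists P, (fun i => complex.Re (D 0 i)); split=> //.
  by rewrite -defD -invmx_unitary.
rewrite (map_comp (@complex.Re R) (fun i => D 0 i)); apply: perm_map.
apply: prod_XsubC_eq; rewrite /spectrum; case: closed_field_poly_normal => s /= defs.
move: defs; rewrite (eqP (char_poly_monic _)) scale1r => <-.
rewrite big_map big_enum /=.
have -> : char_poly AC = char_poly (diag_mx D).
  rewrite defA /char_poly /char_poly_mx.
  (* Scalar matrices are central, so the conjugation passes outside and cancels in the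
     determinant. *)
  have -> : 'X%:M - map_mx polyC (invmx P *m diag_mx D *m P) =
     map_mx polyC (invmx P) *m ('X%:M - map_mx polyC (diag_mx D)) *m map_mx polyC P.
    rewrite mulmxBr mulmxBl !map_mxM /=; congr (_ - _).
    rewrite scalar_mxC -mulmxA -map_mxM mulVmx ?unitarymx_unit //.
    by rewrite map_mx1 mulmx1.
  by rewrite !det_mulmx mulrAC -det_mulmx -map_mxM mulVmx ?unitarymx_unit //
     map_mx1 det1 mul1r.
rewrite char_poly_trig ?diag_mx_is_trig //.
by apply: eq_bigr => i _; rewrite mxE eqxx mulr1n.
Qed.

End SymmetricSpectrum.

(** * Rayleigh quotients and the two lowest levels *)

Section Rayleigh.

Local Open Scope complex_scope.
Local Open Scope sesquilinear_scope.

Variables (R : realType) (m : nat).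
Implicit Types (A : 'M[R]_m) (u v : 'rV[R[i]]_m).

Local Notation sqn z := (complex.Re z ^+ 2 + complex.Im z ^+ 2).

Lemma Re_sum I (r : seq I) (P : pred I) (F : I -> R[i]) :
  complex.Re (\sum_(i <- r | P i) F i) = \sum_(i <- r | P i) complex.Re (F i).
Proof. by apply: (big_morph (@complex.Re R)) => // -[? ?] []. Qed.

(** Reduces complex vectors to real ones: the real part of [(a + ib)(c - ie)] is [ac + be], so no
    mixed terms survive. *)
Lemma quad_complex A v :
  complex.Re ((v *m map_mx (real_complex R) A *m v^t*) 0 0) =
  quad A (map_mx (@complex.Re R) v) + quad A (map_mx (@complex.Im R) v).
Proof.
rewrite mxE Re_sum /quad [X in X + _]exchange_big [X in _ + X]exchange_big /=.
rewrite -big_split /=; apply: eq_bigr => z _.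
rewrite mxE mulr_suml Re_sum -big_split /=; apply: eq_bigr => y _.
rewrite !mxE; case: (v 0 y) => a b; case: (v 0 z) => c e /=; ring.
Qed.

Lemma quad_diag A (P : 'M[R[i]]_m) (d : 'I_m -> R) u : P \is unitarymx ->
    map_mx (real_complex R) A = P^t* *m diag_mx (\row_i (d i)%:C) *m P ->
  quad A (map_mx (@complex.Re R) (u *m P)) +
  quad A (map_mx (@complex.Im R) (u *m P)) = \sum_i d i * sqn (u 0 i).
Proof.
move=> /unitarymxP Pun defA; rewrite -quad_complex defA trmx_mul map_mxM.
rewrite !mulmxA -[u *m P *m _]mulmxA Pun mulmx1.
rewrite -[_ *m P *m _]mulmxA Pun mulmx1 mxE Re_sum.
apply: eq_bigr => i _; rewrite mul_mx_diag !mxE.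
by case: (u 0 i) => a b /=; ring.
Qed.

(** Parseval's identity, as the diagonalization of the identity matrix. *)
Lemma sum_sqn_unitary (P : 'M[R[i]]_m) u : P \is unitarymx ->
  quad 1%:M (map_mx (@complex.Re R) (u *m P)) +
  quad 1%:M (map_mx (@complex.Im R) (u *m P)) = \sum_i sqn (u 0 i).
Proof.
move=> Pun; rewrite (@quad_diag _ P (fun=> 1)) //.
  by apply: eq_bigr => i _; rewrite mul1r.
have -> : diag_mx (\row__ 1%:C) = 1%:M :> 'M[R[i]]_m.
  by apply/matrixP => i j; rewrite !mxE.
by rewrite map_mx1 mulmx1 -invmx_unitary // mulVmx // unitarymx_unit.
Qed.

Lemma sqn_ge0 (z : R[i]) : 0 <= sqn z.
Proof. by rewrite addr_ge0 ?sqr_ge0. Qed.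

Lemma sqn_eq0 (z : R[i]) : (sqn z == 0) = (z == 0).
Proof. by case: z => a b; rewrite paddr_eq0 ?sqr_ge0 // !sqrf_eq0 eq_complex. Qed.

(** Rows [i] and [j] of [P] span a plane, and vanishing at [k] is a single linear condition. *)
Lemma exists_row_eq0 (P : 'M[R[i]]_m) (k i j : 'I_m) : i != j ->
  exists u : 'rV[R[i]]_m, [/\ u != 0, (u *m P) 0 k = 0 &
    forall l, l != i -> l != j -> u 0 l = 0].
Proof.
move=> iNj; have [Pi0|Pi_neq0] := eqVneq (P i k) 0.
  exists (delta_mx 0 i); split.
  - by apply/eqP => /rowP/(_ i); rewrite !mxE !eqxx; apply/eqP/oner_neq0.
  - by rewrite -rowE mxE.
  - by move=> l lNi _; rewrite mxE (negPf lNi) andbF.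
exists (P j k *: delta_mx 0 i - P i k *: delta_mx 0 j); split.
- apply/eqP => /rowP/(_ j); rewrite !mxE !eqxx eq_sym (negPf iNj) mulr0 mulr1.
  by move/eqP; rewrite sub0r oppr_eq0 (negPf Pi_neq0).
- by rewrite mulmxBl -!scalemxAl -!rowE !mxE mulrC subrr.
- by move=> l lNi lNj; rewrite !mxE (negPf lNi) (negPf lNj) andbF !mulr0 subrr.
Qed.

(* Courant-Fischer for the two lowest levels: [A k k] is a Rayleigh quotient, and
   any two eigenvectors span a nonzero vector vanishing at [k]. *)
Lemma energies_gap A (k : 'I_m) (t : R) :
    (1 < m)%N -> A^T = A ->
    (forall x : 'rV[R]_m, x 0 k = 0 -> t * quad 1%:M x <= quad A x) ->
  let E := energies (map_mx (real_complex R) A) in t - A k k <= E`_1 - E`_0.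
Proof.
move=> m_gt1 symA At /=.
have [P [d [Pun defA]]] := symmetric_diagonalization symA.
rewrite /energies; set s := [seq _ | _ <- _] => s_d.
set E := sort _ s.
have perm_E : perm_eq E [seq d i | i <- enum 'I_m].
  by rewrite perm_sort.
have sortE : sorted <=%R E by apply: sort_sorted; apply: le_total.
have sizeE : size E = m by rewrite (perm_size perm_E) size_map size_enum_ord.
(* With [u] the coordinates of the basis vector at [k] in the eigenbasis, [A k k] is the average of
   the [d i] with weights [|u_i|^2], so not all [d i] exceed it. *)
have [i di] : exists i, d i <= A k k.
  apply/not_existsP => dgt.
  pose u : 'rV_m := delta_mx 0 k *m P^t*.
  have uP : u *m P = delta_mx 0 k.
    by rewrite -mulmxA -invmx_unitary // mulVmx ?mulmx1 // unitarymx_unit.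
  have := sum_sqn_unitary u Pun; have := quad_diag u Pun defA; rewrite uP.
  have -> : map_mx (@complex.Re R) (delta_mx 0 k) = delta_mx 0 k :> 'rV_m.
    by apply/rowP => i; rewrite !mxE; case: (_ && _).
  have -> : map_mx (@complex.Im R) (delta_mx 0 k) = 0 :> 'rV_m.
    by apply/rowP => i; rewrite !mxE; case: (_ && _).
  have quad0 (B : 'M[R]_m) : quad B 0 = 0.
    by rewrite /quad big1 // => y _; apply: big1 => z _; rewrite mxE !mul0r.
  have quadk (B : 'M[R]_m) : quad B (delta_mx 0 k) = B k k.
    rewrite /quad (bigD1 k) //= [X in _ + X]big1 ?addr0 => [|y yNk]; last first.
      by apply: big1 => z _; rewrite mxE (negPf yNk) andbF !mul0r.
    rewrite (bigD1 k) //= big1 ?addr0 => [|y yNk].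
      by rewrite mxE !eqxx mul1r mulr1.
    by rewrite [X in _ * X]mxE (negPf yNk) andbF mulr0.
  rewrite !quad0 !quadk !addr0 mxE eqxx mulr1n => Akk sum1.
  have : \sum_i (d i - A k k) * (complex.Re (u 0 i) ^+ 2 + complex.Im (u 0 i) ^+ 2) = 0.
    under eq_bigr do rewrite mulrBl.
    by rewrite sumrB -mulr_sumr -sum1 -Akk mulr1 subrr.
  move/eqP; rewrite psumr_eq0 => [/allP u0|i _]; last first.
    by rewrite mulr_ge0 ?sqn_ge0 // subr_ge0 ltW // real_ltNge ?num_real //; apply/negP.
  move: sum1; rewrite big1 => [/eqP|i _]; first by rewrite oner_eq0.
  have := u0 i (mem_index_enum _); rewrite /= mulf_eq0 subr_eq0 => /orP[/eqP dA|/eqP//].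
  by case: (dgt i); rewrite dA.
have E0 : E`_0 <= A k k.
  have : d i \in E by rewrite (perm_mem perm_E) map_f ?mem_enum.
  move/(nthP 0) => [a aE Ea]; apply: le_trans di; rewrite -Ea.
  by apply: (sorted_leq_nth le_trans le_refl 0 sortE) => //; apply: leq_ltn_trans aE.
have E1 : t <= E`_1.
  rewrite leNgt; apply/negP => E1t.
  (* By sortedness both of the first two entries lie below [t], which yields two distinct indices
     with eigenvalue below [t]. *)
  have cntE : (1 < count (< t) E)%N.
    case: (E) sizeE sortE E1t => [|e0 [|e1 r]] /= sz; try by move: m_gt1; rewrite -sz.
    by move=> /andP[e01 _] e1t; rewrite (le_lt_trans e01 e1t) e1t.
  have : (1 < #|[pred i | (d i < t)%R]|)%N.
    rewrite cardE size_filter -enumT; move: cntE.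
    by rewrite (seq.permP perm_E) count_map.
  case/card_gt1P => i1 [i2 [/= di1 di2 i1Ni2]]; rewrite !inE in di1 di2.
  (* The hypothesis gives this combination a Rayleigh quotient of at least [t], while both of its
     eigenvalues are below [t]; this forces [u = 0]. *)
  have [u [u_neq0 uk u0]] := exists_row_eq0 P k i1Ni2.
  have uRe : map_mx (@complex.Re R) (u *m P) 0 k = 0 by rewrite mxE uk.
  have uIm : map_mx (@complex.Im R) (u *m P) 0 k = 0 by rewrite mxE uk.
  have := lerD (At _ uRe) (At _ uIm).
  rewrite -mulrDr sum_sqn_unitary // (quad_diag u Pun defA) mulr_sumr => le_sum.
  have term_ge0 l : 0 <= (t - d l) * (complex.Re (u 0 l) ^+ 2 + complex.Im (u 0 l) ^+ 2).
    have [->|lNi1] := eqVneq l i1; first by rewrite mulr_ge0 ?sqn_ge0 // subr_ge0 ltW.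
    have [->|lNi2] := eqVneq l i2; first by rewrite mulr_ge0 ?sqn_ge0 // subr_ge0 ltW.
    by rewrite u0 //= expr0n /= addr0 mulr0.
  have : \sum_l (t - d l) * (complex.Re (u 0 l) ^+ 2 + complex.Im (u 0 l) ^+ 2) == 0.
    rewrite eq_le sumr_ge0 ?andbT // -subr_ge0 add0r -sumrN.
    under eq_bigr do rewrite -mulNr opprB mulrBl.
    by rewrite sumrB subr_ge0.
  rewrite psumr_eq0 // => /allP z; case/eqP: u_neq0; apply/rowP => l; rewrite mxE.
  have [li1|lNi1] := eqVneq l i1; last have [li2|lNi2] := eqVneq l i2; last by rewrite u0.
  - have := z l (mem_index_enum _); rewrite /= mulf_eq0 subr_eq0 li1 sqn_eq0.
    by rewrite gt_eqF //= => /eqP.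
  - have := z l (mem_index_enum _); rewrite /= mulf_eq0 subr_eq0 li2 sqn_eq0.
    by rewrite gt_eqF //= => /eqP.
by apply: lerB.
Qed.

End Rayleigh.

(** Substitute [x = f g]. Then [quad A x] exceeds the sum of [g^2 f (A f)] by the sum of
    [- A y z f y f z (g y - g z)^2 / 2], whose terms are nonnegative off the diagonal and zero on
    it. At [k] the factor [g] vanishes. *)
Lemma quad_ge (R : realFieldType) m (A : 'M[R]_m) (f : 'I_m -> R) (k : 'I_m) (t : R) :
    A^T = A -> (forall y z, y != z -> A y z <= 0) -> (forall z, 0 < f z) ->
    (forall z, z != k -> t * f z <= \sum_y A z y * f y) ->
  forall x : 'rV[R]_m, x 0 k = 0 -> t * quad 1%:M x <= quad A x.
Proof.
move=> symA Aoff f_gt0 Af x xk.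
pose g z := x 0 z / f z.
have xE z : x 0 z = f z * g z by rewrite mulrC divfK // gt_eqF.
have symE y z : A y z = A z y by rewrite -[in LHS]symA mxE.
have -> : quad 1%:M x = \sum_y f y ^+ 2 * g y ^+ 2.
  by rewrite quad1; apply: eq_bigr => y _; rewrite xE exprMn.
apply: (@le_trans _ _ (\sum_y g y ^+ 2 * f y * \sum_z A y z * f z)).
  rewrite mulr_sumr; apply: ler_sum => y _.
  have [->|yNk] := eqVneq y k; first by rewrite /g xk mul0r expr0n /= !(mul0r, mulr0).
  rewrite [leLHS](_ : _ = g y ^+ 2 * f y * (t * f y)); last by ring.
  by rewrite ler_wpM2l ?Af // mulr_ge0 ?sqr_ge0 // ltW.
set S := \sum_y _.
(* Symmetrization in [y] and [z], so that the comparison becomes termwise. *)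
have S_sum : S = \sum_y \sum_z A y z * f y * f z * (g y ^+ 2 + g z ^+ 2) / 2.
  under eq_bigr do under eq_bigr do rewrite mulrDr mulrDl.
  under eq_bigr do rewrite big_split.
  rewrite big_split /= [X in _ + X]exchange_big -big_split /=.
  apply: eq_bigr => y _; rewrite mulr_sumr -big_split; apply: eq_bigr => z _ /=.
  by rewrite (symE z y); field.
rewrite S_sum; apply: ler_sum => y _; apply: ler_sum => z _; rewrite !xE.
have [->|yNz] := eqVneq y z; first by rewrite le_eqVlt; apply/orP; left; apply/eqP; field.
rewrite -subr_ge0.
have -> : f y * g y * A y z * (f z * g z) -
   A y z * f y * f z * (g y ^+ 2 + g z ^+ 2) / 2 =
   - A y z * (f y * f z) * (g y - g z) ^+ 2 / 2 by field.
rewrite mulr_ge0 ?invr_ge0 // mulr_ge0 ?sqr_ge0 // mulr_ge0 ?oppr_ge0 ?Aoff //.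
by rewrite mulr_ge0 // ltW.
Qed.

(** * The spectral gap *)

Section Hamiltonian.

Local Open Scope complex_scope.

Variables (R : realType) (n : nat) (pi : 'S_(2 ^ n)).
Implicit Types (s : R) (y z : 'I_(2 ^ n)).

Definition energy z : nat := weight ((pi^-1)%g z).

Definition real_hamiltonian s : 'M[R]_(2 ^ n) := \matrix_(y, z)
  (((1 - s) * n%:R / 2 + s * (energy z)%:R) *+ (y == z) - (1 - s) / 2 *+ edge y z).

Lemma hamiltonianE s :
  hamiltonian pi s = map_mx (real_complex R) (real_hamiltonian s).
Proof.
apply/matrixP => y z; rewrite !mxE !summxE.
have -> : \sum_i (2^-1 *: (1%:M - sigma_x R i)) y z =
    2^-1 * (n%:R *+ (y == z) - (edge y z)%:R) :> R[i].
  under eq_bigr do rewrite !mxE.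
  rewrite -mulr_sumr sumrB sumr_const card_ord -natr_sum sum_is_flip.
  by case: (y == z); rewrite ?mulr1n ?mulr0n ?mul0rn.
have -> : \sum_x ((weight ((pi^-1)%g x))%:R *: delta_mx x x) y z =
    (energy z)%:R *+ (y == z) :> R[i].
  rewrite (bigD1 z) //= big1 => [|x xNz].
    by rewrite !mxE eqxx andbT addr0 mulr_natr.
  by rewrite !mxE [z == x]eq_sym (negPf xNz) andbF mulr0.
by case: (y == z); case: (edge y z); rewrite ?mulr1n ?mulr0n; field.
Qed.

Lemma real_hamiltonian_sym s : (real_hamiltonian s)^T = real_hamiltonian s.
Proof.
apply/matrixP => y z; rewrite !mxE edge_sym eq_sym.
by case: eqVneq => [->|].
Qed.

Hypothesis pi_far :
  forall a b, a \in light n -> b \in light n -> a != b -> ~~ dist_le2 (pi a) (pi b).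

Lemma light_energy z : ((pi^-1)%g z \in light n) = (10 * energy z <= n)%N.
Proof. by rewrite inE. Qed.

Lemma low_far y z : (10 * energy y <= n)%N -> (10 * energy z <= n)%N -> y != z ->
  ~~ dist_le2 y z.
Proof.
rewrite -!light_energy => ly lz yNz.
by have := pi_far ly lz; rewrite !permKV (inj_eq perm_inj); apply.
Qed.

Lemma gap_lower_bound s : (81 <= n)%N -> 9 / 10 <= s <= 1 -> 81 / 100 <= gap pi s.
Proof.
move=> n_ge /andP[s_ge s_le]; rewrite /gap hamiltonianE.
have nR : 81%:R <= n%:R :> R by rewrite ler_nat.
have k_lt : (0 < 2 ^ n)%N by rewrite expn_gt0.
pose k := pi (Ordinal k_lt).
have energy_k : energy k = 0%N by rewrite /energy permK weight0.
have energy_gt0 z : z != k -> 1 <= (energy z)%:R :> R.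
  move=> zNk; rewrite ler1n lt0n; apply: contra zNk => /eqP e0.
  by rewrite /k -(weight_eq0 e0 (weight0 (z := Ordinal k_lt) erefl)) permKV.
pose low z := (10 * energy z <= n)%N.
(* At [s = 9/10], low vertices ask for [K >= 5n/9] and the others for [K <= 4n/5 - 76/5]; for
   [n >= 81] the value [3n/5] meets both. *)
pose K : R := 3 / 5 * n%:R.
pose f z : R := if low z then K else 1.
have f_gt0 z : 0 < f z by rewrite /f; case: ifP => // _; rewrite /K; lra.
(* The Rayleigh quotient at [k] plus [81/100], which leaves room for a strict bound by [8/10]. *)
pose t : R := (1 - s) * n%:R / 2 + 81 / 100.
pose A := real_hamiltonian s.
have Af z : z != k -> t * f z <= \sum_y A z y * f y.
  move=> zNk.
  have -> : \sum_y A z y * f y = ((1 - s) * n%:R / 2 + s * (energy z)%:R) * f z -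
      (1 - s) / 2 * \sum_y (edge z y)%:R * f y.
    under eq_bigr do rewrite mxE mulrBl.
    rewrite sumrB (bigD1 z) //= eqxx mulr1n big1 ?addr0 => [|y yNz].
      rewrite mulr_sumr; congr (_ - _); apply: eq_bigr => y _.
      by rewrite -mulr_natr mulrA.
    by rewrite eq_sym (negPf yNz) mulr0n mul0r.
  have degR : \sum_y (edge z y)%:R <= n%:R :> R.
    by rewrite -natr_sum ler_nat edge_degree.
  have := energy_gt0 z zNk.
  have [lz|hz] := boolP (low z).
    (* A low vertex has no low neighbour, so [f] is 1 on all its neighbours. *)
    have -> : \sum_y (edge z y)%:R * f y = \sum_y (edge z y)%:R.
      apply: eq_bigr => y _; case: (boolP (edge z y)) => [zy|]; last by rewrite !mul0r.
      rewrite /f; case: ifP => [ly|_]; last by rewrite mulr1.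
      have zNy : z != y by apply: contraTneq zy => ->; rewrite edge_irr.
      by have := low_far lz ly zNy; rewrite /dist_le2 zy.
    move: degR; set S := \sum_y _; set N : R := n%:R; set e : R := (energy z)%:R => SN e1.
    have se : 0 <= N * (s * e - 9 / 10) by apply: mulr_ge0; rewrite /N; nra.
    have gS : (1 - s) / 2 * S <= N / 20 by nra.
    rewrite /f lz /K /t -/N -subr_ge0.
    rewrite [leRHS](_ : _ = 3 / 5 * (N * (s * e - 9 / 10)) + (27 / 50 - 243 / 500) * N
      - (1 - s) / 2 * S); last by field.
    by rewrite /N in se gS *; lra.
  (* Two low neighbours of [z] would be at distance two through [z], so at most one neighbour adds
     the excess [K - 1]. *)
  have : \sum_y (edge z y)%:R * f y <= n%:R + (K - 1).
    have -> : \sum_y (edge z y)%:R * f y =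
        \sum_y (edge z y)%:R + \sum_y (edge z y)%:R * (f y - 1).
      by rewrite -big_split; apply: eq_bigr => y _ /=; ring.
    apply: lerD => //.
    have K_ge : 0 <= K - 1 by rewrite /K; lra.
    have [y0 /andP[zy0 ly0]|nolow] := pickP (fun y => edge z y && low y).
      rewrite (bigD1 y0) //= zy0 mul1r {1}/f ly0 big1 ?addr0 // => y yNy0.
      case: (boolP (edge z y)) => [zy|]; last by rewrite mul0r.
      rewrite /f; case: ifP => [ly|_]; last by rewrite subrr mulr0.
      have := low_far ly ly0 yNy0; rewrite /dist_le2 negb_or => /andP[_ /existsP[]].
      by exists z; rewrite edge_sym zy.
    rewrite big1 // => y _; have := nolow y.
    case: (edge z y) => /= [ly|_]; last by rewrite mul0r.
    by rewrite /f ly subrr mulr0.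
  have : n%:R <= 10 * (energy z)%:R :> R.
    by rewrite -natrM ler_nat ltnW // ltnNge.
  set S := \sum_y _; set e : R := (energy z)%:R => e_ge S_le _.
  have se : 9 / 10 * e <= s * e by nra.
  have gS : (1 - s) / 2 * S <= 1 / 20 * (n%:R + (K - 1)) by rewrite /K in S_le *; nra.
  rewrite /f (negPf hz) /t -subr_ge0.
  rewrite [leRHS](_ : _ = s * e - 81 / 100 - (1 - s) / 2 * S); last by field.
  by rewrite /K in gS; lra.
have -> : 81 / 100 = t - A k k.
  rewrite /A mxE eqxx edge_irr energy_k mulr0 addr0 mulr0n subr0 mulr1n.
  by rewrite /t addrAC subrr add0r.
apply: energies_gap; first by rewrite -{1}(expn0 2) ltn_exp2l //; apply: leq_trans n_ge.
  exact: real_hamiltonian_sym.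
apply: (quad_ge (f := f)) => //; first exact: real_hamiltonian_sym.
move=> y z yNz; rewrite mxE (negPf yNz) mulr0n sub0r oppr_le0.
by rewrite mulrn_wge0 // divr_ge0 // subr_ge0.
Qed.

End Hamiltonian.

(** * The union bound and the limit *)

Lemma prob_perm_le1 (R : realType) m (P : 'S_m -> Prop) : prob_perm R P <= 1.
Proof.
rewrite /prob_perm cardsT card_Sn ler_pdivrMr ?ltr0n ?fact_gt0 // mul1r ler_nat.
by rewrite -card_Sn max_card.
Qed.

Lemma prob_perm_ge (R : realType) n (P : 'S_(2 ^ n) -> Prop) : (0 < n)%N ->
    (forall pi : 'S_(2 ^ n),
      (forall a b, a \in light n -> b \in light n -> a != b ->
        ~~ dist_le2 (pi a) (pi b)) -> P pi) ->
  1 - (#|light n| ^ 2 * (n + n * n))%:R / (2 ^ n).-1%:R <= prob_perm R P.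
Proof.
move=> n_gt0 farP; set m := (2 ^ n)%N.
have m1_gt0 : (0 < m.-1)%N by rewrite -ltnS prednK ?expn_gt0 // -{1}(expn0 2) ltn_exp2l.
pose bad : {set 'S_m} := [set s : 'S_m | [exists a in light n, exists b in light n,
  (a != b) && dist_le2 (s a) (s b)]]%SET.
have card_bad := card_perm_related_in (@dist_le2_degree n) (light n).
rewrite /prob_perm cardsT card_Sn ler_pdivlMr ?ltr0n ?fact_gt0 // mulrBl mul1r.
rewrite lerBlDr -lerBlDl; apply: (@le_trans _ _ #|bad|%:R); last first.
  rewrite mulrAC ler_pdivlMr ?ltr0n // mulrC -!natrM ler_nat.
  by apply: leq_trans card_bad _; rewrite mulnA mulnn.
rewrite lerBlDl -natrD ler_nat -card_Sn -(cardsC bad) addnC leq_add2r.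
apply: subset_leq_card; apply/fintype.subsetP => s; rewrite !inE => s_good.
apply: farP => a b aL bL aNb; apply: contra s_good => ab.
by apply/exists_inP; exists a => //; apply/exists_inP; exists b; rewrite ?aNb.
Qed.

(** Bernoulli's inequality [n x <= (1 + x)^n], in the form used to absorb polynomial factors into
    geometric ones. *)
Lemma natr_expr_bounded (R : realFieldType) (x : R) n : 0 < x ->
  n%:R * (1 + x) ^- n <= x^-1.
Proof.
move=> x_gt0; have x1_gt0 : 0 < (1 + x) ^+ n by rewrite exprn_gt0 // addr_gt0.
rewrite ler_pdivrMr // ler_pdivlMl //.
elim: n {x1_gt0} => [|n IHn]; first by rewrite mulr0 expr0 ler01.
rewrite exprS -natr1 mulrDr mulr1 mulrDl mul1r.
apply: lerD => //; apply: ler_peMr; first exact: ltW.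
by rewrite exprn_ege1 // lerDl ltW.
Qed.

(** Since [(45/32)^2 <= 2 q^3], dividing by [2^n / 2] leaves [q^(3n)]. Two of the three factors
    [q^n] absorb the [n^2] from the degree, at the cost of [C^2], and the third gives the decay. The
    4 collects the halved denominator and [n + n^2 <= 2 n^2]. *)
Lemma union_bound_le (R : realType) n (q C : R) : (0 < n)%N ->
    0 <= q -> n%:R * q ^+ n <= C -> (45 / 32) ^+ 2 <= q ^+ 3 * 2 ->
  (#|light n| ^ 2 * (n + n * n))%:R / (2 ^ n).-1%:R <= geometric (4 * C ^+ 2) q n.
Proof.
move=> n_gt0 q_ge0 qC q3.
have two_n : (2 ^+ n / 2 : R) <= (2 ^ n).-1%:R.
  have : (1 < 2 ^ n)%N by rewrite -{1}(expn0 2) ltn_exp2l.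
  case: n {n_gt0 qC} => [//|n] _; rewrite exprS mulrC mulKf // -natrX ler_nat expnS.
  by have := expn_gt0 2 n; lia.
have pos : 0 < (2 ^ n).-1%:R :> R.
  by apply: lt_le_trans two_n; rewrite divr_gt0 ?exprn_gt0.
have C_ge0 : 0 <= C by apply: le_trans qC; rewrite mulr_ge0 ?exprn_ge0.
rewrite ler_pdivrMr //; apply: le_trans (ler_wpM2l _ two_n); last first.
  by rewrite /geometric /= mulr_ge0 ?exprn_ge0 // mulr_ge0 ?exprn_ge0.
have light2 : (#|light n| ^ 2)%:R <= ((45 / 32) ^+ 2) ^+ n :> R.
  rewrite natrX exprAC; apply: lerXn2r (card_light R n).
    by rewrite nnegrE ler0n.
  by rewrite nnegrE exprn_ge0 ?divr_ge0 ?ler0n.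
have D_le : (n + n * n)%:R <= 2 * n%:R ^+ 2 :> R.
  by rewrite -natrX -natrM ler_nat mul2n -addnn -mulnn leq_add2r leq_pmulr.
rewrite natrM; apply: (@le_trans _ _ ((q ^+ 3 * 2) ^+ n * (2 * n%:R ^+ 2))).
  apply: ler_pM => //; apply: le_trans light2 _.
  by apply: lerXn2r q3; rewrite nnegrE ?sqr_ge0 // mulr_ge0 ?exprn_ge0.
have qn : (n%:R * q ^+ n) ^+ 2 <= C ^+ 2.
  by apply: lerXn2r; rewrite ?nnegrE ?mulr_ge0 ?exprn_ge0.
rewrite /geometric /= exprMn exprAC.
rewrite [leLHS](_ : _ = 2 * 2 ^+ n * (q ^+ n * (n%:R * q ^+ n) ^+ 2)); last by ring.
rewrite [leRHS](_ : _ = 2 * 2 ^+ n * (q ^+ n * C ^+ 2)); last by field.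
by rewrite !ler_wpM2l ?mulr_ge0 ?exprn_ge0.
Qed.

Local Open Scope classical_set_scope.
Local Open Scope ring_scope.

Theorem theorem3 (R : realType) :
  (fun n : nat =>
     prob_perm R (fun pi : 'S_(2 ^ n) =>
       forall s : R, 9 / 10 <= s <= 1 -> 8 / 10 < gap pi s))
    @ \oo --> (1 : R).
Proof.
(* Small enough that [2 q^3] stays above [(45/32)^2], which is about 1.978. *)
pose x : R := 300^-1; pose q := (1 + x)^-1.
have x_gt0 : 0 < x by rewrite /x; lra.
have x_small : x * 300 = 1 by rewrite /x; field.
have q_ge0 : 0 <= q by rewrite invr_ge0 addr_ge0 // ltW.
have q3 : (45 / 32) ^+ 2 <= q ^+ 3 * 2.
  have : 1 - x <= q by rewrite -[q]mul1r ler_pdivlMr ?addr_gt0 //; nra.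
  (* This is the tangent bound [q^3 >= 3q - 2]; with [q >= 1 - x] it gives
     [2 q^3 >= 2 - 6x = 1.98]. *)
  have : 0 <= (q - 1) ^+ 2 * (q + 2) by rewrite mulr_ge0 ?sqr_ge0 ?addr_ge0.
  rewrite (_ : _ * _ = q ^+ 3 - 3 * q + 2); last by ring.
  by clearbody x; move: (q ^+ 3) (q) x_small => a b; lra.
apply: (@squeeze_cvgr _ _ _ _ (fun n => 1 - geometric (4 * x^-1 ^+ 2) q n : R)
  (fun=> 1)); last 2 first.
- rewrite -[X in _ --> X]subr0; apply: cvgB; first exact: cvg_cst.
  by apply: cvg_geometric; rewrite ger0_norm // invf_lt1 ?ltrDl // addr_gt0.
- exact: cvg_cst.
exists 81%N => // n /= n_ge; have n_gt0 : (0 < n)%N by apply: leq_trans n_ge.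
rewrite prob_perm_le1 andbT; apply: (le_trans _ (@prob_perm_ge R n _ n_gt0 _)).
  rewrite lerD2l lerN2; apply: union_bound_le => //.
  by rewrite exprVn natr_expr_bounded.
move=> pi pi_far s s01; apply: lt_le_trans (gap_lower_bound pi_far n_ge s01).
lra.
Qed.
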